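(* Let $d\ge2$ and let $P$ be a fixed $d$-dimensional 0-1 matrix with $\mathrm{ex}(n,P,d)=O(n^{d-1})$. Suppose that one of the following operations is performed to yield a family of $d$-dimensional 0-1 matrices $\{P_j\}_{j\ge1}$. Then the Ramsey numbers of the ordered hypergraphs $\mathcal G_{P_j}$ grow linearly with respect to their size, i.e. $R(\mathcal G_{P_j})=\Theta(v(\mathcal G_{P_j}))$, where the implied constants are independent of $j$ and $v(\mathcal G_{P_j})$ is the number of vertices. 1. Assume $P$ has a one in its first or last hyperplane in some dimension. Let $P_j$ be obtained from $P$ by performing $j$ times in succession the following operation: add a new first (or last) hyperplane in some dimension, containing exactly one 1, placed next to a 1 of the current matrix (which lies in the adjacent, formerly first or last, hyperplane in that dimension). 2. Assume $P$ has two adjacent ones in some $1$-row. Let $P_j$ be obtained from $P$ by inserting $j$ new hyperplanes between the two hyperplanes (fixed first coordinate) containing these ones, each new hyperplane having exactly one 1, which lies in the $1$-row of the two adjacent ones. 3. Assume $P$ has two adjacent ones in a top $1$-row $\rho$. Let $P'$ be obtained from $P$ by first inserting two empty hyperplanes $A$ and $B$ (fixed first coordinate) between the two hyperplanes (fixed first coordinate) containing these two ones, and then adding a new hyperplane directly above the resulting matrix (a new first hyperplane in the $d$-th dimension) with exactly two ones, which lie in $A$ and $B$ and directly above the $1$-row $\rho$. Let $P_j$ be obtained from $P'$ by inserting $j$ new hyperplanes between the two hyperplanes (fixed first coordinate) containing the two adjacent ones of the new top hyperplane, each new hyperplane having exactly one 1, which lies in the $1$-row of those two adjacent ones. 4.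 Assume $P$ has ones in two opposite corners. Let $P_0=P$ and, for $j\ge1$, let $P_j$ be obtained from $P_{j-1}$ and a copy of $P$ by placing them so that the corner one of $P_{j-1}$ (in the second of these corner positions) is in the same location as the one of the copy of $P$ in the opposite (first) corner position, with all entries outside these two matrices equal to zero. 5. (No additional requirement on $P$.) Let $P_j$ be obtained from $P$ by inserting $j$ empty hyperplanes between every adjacent pair of hyperplanes of $P$ (in every dimension).
   Context: A $d$-dimensional 0-1 matrix is an array of zeros and ones indexed by $[n_1]\times\dots\times[n_d]$. In this setting a hyperplane means a $(d-1)$-dimensional hyperplane of entries, i.e. the set of entries with one coordinate fixed; it is empty if all its entries are zero. An $i$-row is a maximal set of entries with all coordinates the same except the $i$-th. A top $1$-row is a $1$-row with minimal $d$-th coordinate, and ''directly above'' refers to a smaller $d$-th coordinate. Two corners are opposite if they differ extremally in every coordinate (each coordinate is minimal in one and maximal in the other). $A$ contains $P$ if some submatrix of $A$ (obtained by deleting hyperplanes) equals $P$ or can be turned into $P$ by changing ones to zeroes; otherwise $A$ is $P$-free. $\mathrm{ex}(n,P,d)$ is the maximum number of ones in a $P$-free $d$-dimensional 0-1 matrix of sidelength $n$ in every dimension. An ordered $d$-uniform hypergraph is a $d$-uniform hypergraph with a linear ordering of its vertices; copies are order-preserving injections mapping hyperedges to hyperedges. $R(\mathcal G)$ is the minimum $N$ such that every 2-coloring of the hyperedges of the complete ordered $d$-uniform hypergraph on $N$ vertices contains a monochromatic copy of $\mathcal G$. For an $n_1\times\dots\times n_d$ 0-1 matrix $P$, $\mathcal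 G_P$ is the ordered $d$-partite $d$-uniform hypergraph whose vertex set consists of $d$ consecutive intervals $V_1<\dots<V_d$ with $|V_i|=n_i$, where each entry $P(i_1,\dots,i_d)=1$ gives a hyperedge consisting of the $i_1$-th vertex of $V_1$, ..., the $i_d$-th vertex of $V_d$. *)

(* Defs.v *)
From HB Require Import structures.
From mathcomp Require Import all_boot all_order.

Set Implicit Arguments.
Unset Strict Implicit.
Unset Printing Implicit Defensive.

(* Coordinates are 0-based: [n_1] x ... x [n_d] is represented by the dependent
   finite functions sending i : 'I_d to an element of 'I_(n i). *)

Notation idx n := {dffun forall i, 'I_(n i)}.

Notation array n := {ffun idx n -> bool}.

Record mat (d : nat) := Mat { side : 'I_d -> nat; entries :> array side }.

Definition weight d (n : 'I_d -> nat) (A : array n) : nat := #|[set x | A x]|.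

Definition increasing m n (f : {ffun 'I_m -> 'I_n}) : bool :=
  [forall a : 'I_m, forall b : 'I_m, (a < b) ==> (f a < f b)].

(* Deleting hyperplanes amounts to keeping, in each dimension, the positions
   in the image of a strictly increasing map. *)
Definition submatrix d (m n : 'I_d -> nat)
    (f : {dffun forall i : 'I_d, {ffun 'I_(m i) -> 'I_(n i)}})
    (A : array n) : array m :=
  [ffun x : idx m => A [ffun i => f i (x i)]].

Definition contains d (n : 'I_d -> nat) (A : array n) (P : mat d) : bool :=
  [exists f : {dffun forall i : 'I_d, {ffun 'I_(side P i) -> 'I_(n i)}},
     [forall i, increasing (f i)] &&
     [forall x : idx (side P), P x ==> submatrix f A x]].

(* The value is 0 when there is no P-free matrix of sidelength n, that is when
   P has no ones and n is at least all its sides. *)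
Definition extremal (n : nat) d (P : mat d) : nat :=
  \max_(A : array (fun _ : 'I_d => n) | ~~ contains A P) weight A.

Definition ex_bigO d (P : mat d) : Prop :=
  exists C n0, forall n, n0 <= n -> extremal n P <= C * n ^ (d - 1).

(* Up to isomorphism, a linearly ordered vertex set is 'I_v. *)
Record ohypergraph (d : nat) := OHypergraph {
  nvert : nat;
  edges : {set {set 'I_nvert}};
  edges_uniform : forall e, e \in edges -> #|e| = d }.

Definition has_copy d (G H : ohypergraph d) : Prop :=
  exists2 f : {ffun 'I_(nvert G) -> 'I_(nvert H)},
    increasing f & forall e, e \in edges G -> f @: e \in edges H.

(* The hyperedges of colour b in the complete ordered d-uniform hypergraph on
   N vertices; values of c on sets of size other than d are irrelevant. *)
Definition colour_edges (d N : nat) (c : {set 'I_N} -> bool) (b : bool) :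
    {set {set 'I_N}} :=
  [set e : {set 'I_N} | (#|e| == d) && (c e == b)].

Lemma colour_uniform d N (c : {set 'I_N} -> bool) b e :
  e \in colour_edges d c b -> #|e| = d.
Proof. by rewrite inE => /andP[/eqP]. Qed.

Definition colour_class d N (c : {set 'I_N} -> bool) (b : bool) :
  ohypergraph d := OHypergraph (@colour_uniform d N c b).

Definition ramsey_property d (G : ohypergraph d) (N : nat) : Prop :=
  forall c : {set 'I_N} -> bool, exists b, has_copy G (colour_class d c b).

(* R(G) = r, including the existence of the minimum. *)
Definition ramsey_number d (G : ohypergraph d) (r : nat) : Prop :=
  ramsey_property G r /\ forall N, ramsey_property G N -> r <= N.

(* tagnat.Rank i a is the a-th vertex of the i-th of the consecutive intervals
   of lengths side P 0, side P 1, ... (see tagnat.RankEsum). *)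
Definition hyperedge d (n : 'I_d -> nat) (x : idx n) :
  {set 'I_(\sum_(i < d) n i)} := [set tagnat.Rank i (x i) | i : 'I_d].

Definition mat_edges d (P : mat d) : {set {set 'I_(\sum_(i < d) side P i)}} :=
  [set hyperedge x | x : idx (side P) & P x].

Lemma mat_edges_uniform d (P : mat d) e : e \in mat_edges P -> #|e| = d.
Proof.
case/imsetP=> x _ ->; rewrite card_imset ?card_ord // => i j eq_ij.
by rewrite -(tagnat.Rank1K (x i)) eq_ij tagnat.Rank1K.
Qed.

Definition hypergraph_of d (P : mat d) : ohypergraph d :=
  OHypergraph (@mat_edges_uniform d P).

(* The entry of P at a point with natural number coordinates, 0 outside P. *)
Definition entry d (P : mat d) (u : 'I_d -> nat) : bool :=
  [exists x : idx (side P), P x && [forall i, x i == u i :> nat]].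

Definition build d (n : 'I_d -> nat) (f : ('I_d -> nat) -> bool) : mat d :=
  @Mat d n [ffun x : idx n => f (fun i => x i : nat)].

(* Insert m hyperplanes in dimension i, at positions p, ..., p + m - 1 of the
   result; B gives their entries, in the coordinates of the result. *)
Definition insert_planes d (i : 'I_d) (p m : nat) (B : ('I_d -> nat) -> bool)
    (P : mat d) : mat d :=
  build (fun k => if k == i then side P k + m else side P k)
    (fun w => if w i < p then entry P w
              else if w i < p + m then B w
              else entry P (fun k => if k == i then w k - m else w k)).

Definition same_row d (i : 'I_d) (u w : 'I_d -> nat) : bool :=
  [forall k, (k != i) ==> (w k == u k)].

Definition pos d (n : 'I_d -> nat) (x : idx n) : 'I_d -> nat := fun i => x i.

(* The new one next to the one at x is the entry of the new hyperplane that
   lies in the i-row of x. *)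
Definition add_end_plane d (Q Q' : mat d) : Prop :=
  exists (i : 'I_d) (x : idx (side Q)), Q x /\
    ((x i = 0 :> nat /\
        Q' = insert_planes i 0 1 (same_row i (pos x)) Q) \/
     ((x i).+1 = side Q i /\
        Q' = insert_planes i (side Q i) 1 (same_row i (pos x)) Q)).

Inductive add_end_planes d (P : mat d) : nat -> mat d -> Prop :=
| AddEnd0 : add_end_planes P 0 P
| AddEndS j Q Q' : add_end_planes P j Q -> add_end_plane Q Q' ->
    add_end_planes P j.+1 Q'.

Definition by_end_planes d (P : mat d) (F : nat -> mat d) : Prop :=
  (exists (i : 'I_d) (x : idx (side P)), P x /\
     (x i = 0 :> nat \/ (x i).+1 = side P i)) /\
  forall j, 1 <= j -> add_end_planes P j (F j).

(* x and y are the positions of two ones of P that are adjacent in an i-row,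
   y immediately following x. *)
Definition adjacent_ones d (P : mat d) (i : 'I_d) (x y : idx (side P)) : Prop :=
  [/\ P x, P y, same_row i (pos x) (pos y) & y i = (x i).+1 :> nat].

Definition by_row_stretch d (P : mat d) (F : nat -> mat d) : Prop :=
  exists (i : 'I_d) (x y : idx (side P)),
    [/\ i = 0 :> nat, adjacent_ones i x y
      & forall j, 1 <= j ->
          F j = insert_planes i (x i).+1 j (same_row i (pos x)) P].

(* Here i is the first dimension and l the last one, and x is in a top i-row,
   so that x l = 0; the points of the new top hyperplane, at position 0 in
   dimension l, that are directly above this row then have the same
   coordinates, except the i-th, as x.  The hyperplanes A and B have positions
   (x i).+1 and (x i).+2 in dimension i. *)
Definition top_augment d (P : mat d) (i l : 'I_d) (x : idx (side P)) : mat d :=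
  insert_planes l 0 1
    (fun w => same_row i (pos x) w &&
              ((w i == (x i).+1) || (w i == (x i).+2)))
    (insert_planes i (x i).+1 2 (fun _ => false) P).

Definition by_top_stretch d (P : mat d) (F : nat -> mat d) : Prop :=
  exists (i l : 'I_d) (x y : idx (side P)),
    [/\ i = 0 :> nat /\ l.+1 = d, adjacent_ones i x y, x l = 0 :> nat
      & forall j, 1 <= j ->
          F j = insert_planes i (x i).+2 j
                  (fun w => same_row i (pos x) w && (w l == 0))
                  (top_augment i l x)].

(* s encodes the corner with minimal i-th coordinate iff s i; the opposite
   corner is encoded by the complement of s. *)
Definition corner d (n : 'I_d -> nat) (s : 'I_d -> bool) : 'I_d -> nat :=
  fun i => if s i then 0 else (n i).-1.

(* Q and P placed so that the corner ~~ s of Q and the corner s of P coincide.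
   In the dimensions i with s i, P comes after Q; in the others, before. *)
Definition glue d (s : 'I_d -> bool) (Q P : mat d) : mat d :=
  let offQ i := if s i then 0 else (side P i).-1 in
  let offP i := if s i then (side Q i).-1 else 0 in
  build (fun i => (side Q i + side P i).-1)
    (fun w => ([forall i, offQ i <= w i] && entry Q (fun i => w i - offQ i)) ||
              ([forall i, offP i <= w i] && entry P (fun i => w i - offP i))).

Definition by_corner_glue d (P : mat d) (F : nat -> mat d) : Prop :=
  exists s : 'I_d -> bool,
    [/\ entry P (corner (side P) s),
        entry P (corner (side P) (fun i => ~~ s i)),
        F 0 = P & forall j, F j.+1 = glue s (F j) P].

(* j empty hyperplanes between adjacent ones: the hyperplane at position a
   moves to position a * j.+1. *)
Definition spread d (j : nat) (P : mat d) : mat d :=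
  build (fun i => side P i + (side P i).-1 * j)
    (fun w => [forall i, j.+1 %| w i] && entry P (fun i => w i %/ j.+1)).

Definition by_spread d (P : mat d) (F : nat -> mat d) : Prop :=
  forall j, 1 <= j -> F j = spread j P.

(* R(G_j) = Theta(v(G_j)), with one constant C for all j >= 1 serving for both
   bounds (the lower bound being R >= v / C). *)
Definition linear_ramsey d (G : nat -> ohypergraph d) : Prop :=
  exists C, forall j, 1 <= j ->
    exists r, [/\ ramsey_number (G j) r,
                  r <= C * nvert (G j) & nvert (G j) <= C * r].

(* Main.v *)
Require Import Defs.
From mathcomp Require Import all_boot all_order.
From mathcomp Require Import zify boolp.

(** Cut the vertex set of the complete ordered hypergraph on [d * n] vertices
    into [d] consecutive intervals of length [n].  A 2-colouring restricted to
    the hyperedges that meet every interval is a pair of complementary arrays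
    of sidelength [n], and one of the two has at least [n ^ d / 2] ones.  If it
    contains [Q], then the hypergraph of [Q] has a monochromatic copy
    ([ramsey_of_arrays]).  So a bound [extremal n (F j) <= K * j * n ^ (d - 1)],
    valid for all [n], gives a Ramsey number of order at most [j]
    ([linear_of_extremal]), and [j] is at most the number of vertices.
    Conversely a copy is an injection of the vertices, so no Ramsey number is
    below the number of vertices.

    It remains to control the growth of the extremal function.

    - A new end plane costs [n ^ (d - 1)]: delete the first (or last) one of
      every row of the relevant direction.  A copy of [Q] in the rest can be
      prolonged by a deleted one ([extremal_first_plane],
      [extremal_last_plane]).
    - Stretching a row by [j] planes multiplies the bound by [j + 1]: in each
      row, split the ones according to their rank modulo [j + 1].  Two ones of
      the same class have at least [j] ones of the array between them
      ([extremal_row_stretch]).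
    - Augmenting at the top turns the bound [e] into [3 * e + n ^ (d - 1)]
      ([extremal_top_augment]).  Here one works in each two-dimensional slice,
      and keeps a set of ones such that between any two kept ones of a row some
      row above has two ones.  The deleted ones are charged either to kept ones
      (each kept one at most twice) or, injectively, to columns of the slice;
      this planar argument is the heart of the proof ([charge_exists],
      [open_boundary]).
    - Glueing adds the bounds: call a one marked if it is the gluing corner of
      a copy of [P].  The unmarked ones contain no [P]; a copy of [Q] in
      the marked ones extends to a glued copy ([extremal_glue]).
    - For spread matrices only the entries whose coordinates are all multiples
      of [j + 1] are used, that is, a 2-colouring of an array whose sidelength
      does not depend on [j] ([ramsey_spread]).

    Gluing or spreading a matrix with all sides at most 1 does not make it
    grow; such a matrix has at most one one, so its Ramsey number is its number
    of vertices ([ramsey_few_ones]). *)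

Set Implicit Arguments.
Unset Strict Implicit.
Unset Printing Implicit Defensive.

(** * Entries at points with natural number coordinates *)

Lemma pos_inj d (n : 'I_d -> nat) : injective (@pos d n).
Proof.
move=> x y /(congr1 (fun f => f _)) exy; apply/ffunP=> i; apply/val_inj.
exact: exy.
Qed.

(** The point [x0] supplies the coordinates that [u] has outside the box. *)
Definition mkidx d (n : 'I_d -> nat) (x0 : idx n) (u : 'I_d -> nat) : idx n :=
  [ffun k => insubd (x0 k) (u k)].

Lemma mkidxK d (n : 'I_d -> nat) (x0 : idx n) u :
  (forall k, u k < n k) -> pos (mkidx x0 u) = u.
Proof.
by move=> hu; apply: funext => k; rewrite /pos ffunE val_insubd hu.
Qed.

Lemma idx_of d (n : 'I_d -> nat) (u : 'I_d -> nat) :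
  (forall k, u k < n k) -> exists x : idx n, pos x = u.
Proof.
move=> hu; exists [ffun k => Ordinal (hu k)].
by apply: funext => k; rewrite /pos ffunE.
Qed.

Lemma entryP d (P : mat d) u :
  reflect (exists2 x : idx (side P), P x & pos x = u) (entry P u).
Proof.
apply: (iffP existsP) => [[x /andP[Px /forallP xu]] | [x Px <-]]; exists x => //.
  by apply: funext => k; exact/eqP/xu.
by rewrite Px; apply/forallP=> k.
Qed.

Lemma entry_pos d (P : mat d) x : entry P (pos x) = P x.
Proof.
by apply/entryP/idP=> [[y Py /pos_inj <-] // | Px]; exists x.
Qed.

Lemma entry_lt d (P : mat d) u i : entry P u -> u i < side P i.
Proof. by case/entryP=> x _ <-; apply: ltn_ord. Qed.

Lemma entry_build d (n : 'I_d -> nat) f u :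
  entry (build n f) u = [forall i, u i < n i] && f u.
Proof.
apply/entryP/andP=> [[x + <-] | [/forallP hu fu]].
  by rewrite ffunE => fx; split=> //; apply/forallP=> k; apply: ltn_ord.
have [x xu] := idx_of hu; exists x => //.
by rewrite ffunE -/(pos x) xu.
Qed.

(** The maps of dimension-wise indices are total functions on [nat], so that
    copies can be prolonged without casts between ordinal types; their values
    outside the sides of [P] are arbitrary. *)
Definition copy d (n : 'I_d -> nat) (A : array n) (P : mat d)
    (f : 'I_d -> nat -> nat) : Prop :=
  [/\ forall i a b, a < b -> b < side P i -> f i a < f i b,
      forall i a, a < side P i -> f i a < n i
    & forall u, entry P u -> entry (Mat A) (fun i => f i (u i))].

Lemma containsP d (n : 'I_d -> nat) (A : array n) (P : mat d) :
  reflect (exists f, copy A P f) (contains A P).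
Proof.
apply: (iffP existsP) => [[f /andP[/forallP incf /forallP fP]] | [f [incf ltf fP]]].
  pose g i a := if insub a is Some b then f i b : nat else 0.
  have gE i (a : 'I_(side P i)) : g i a = f i a.
    by rewrite /g insubT // => ha; congr (nat_of_ord (f i _)); apply/val_inj.
  exists g; split=> [i a b ltab ltb | i a lta | u /entryP[x Px <-]].
  - rewrite (gE i (Ordinal (ltn_trans ltab ltb))) (gE i (Ordinal ltb)).
    by have /forallP/(_ (Ordinal (ltn_trans ltab ltb)))/forallP/(_ (Ordinal ltb)) := incf i;
       move=> /implyP; apply.
  - by rewrite (gE i (Ordinal lta)).
  - have := fP x; rewrite Px ffunE => Ax.
    rewrite -[X in entry _ X](_ : pos [ffun i => f i (x i)] = _) ?entry_pos //.
    by apply: funext => i; rewrite /pos ffunE gE.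
exists [ffun i => [ffun a : 'I_(side P i) => Ordinal (ltf i a (ltn_ord a))]].
apply/andP; split.
  apply/forallP=> i; apply/forallP=> a; apply/forallP=> b; apply/implyP=> ltab.
  by rewrite !ffunE /=; apply: incf.
apply/forallP=> x; apply/implyP=> Px; rewrite ffunE.
have := fP (pos x); rewrite entry_pos => /(_ Px).
set u := (fun i => _) => Au; rewrite -[A _](@entry_pos _ (Mat A)).
rewrite (_ : pos _ = u) //.
by apply: funext => i; rewrite /pos /u !ffunE.
Qed.

(** * The extremal function *)

Lemma weight_le_extremal d n (A : array (fun _ : 'I_d => n)) (P : mat d) :
  ~~ contains A P -> weight A <= extremal n P.
Proof. by move=> nAP; apply: leq_bigmax_cond. Qed.

Lemma extremal_le d n (P : mat d) m :
  (forall A : array (fun _ : 'I_d => n), ~~ contains A P -> weight A <= m) ->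
  extremal n P <= m.
Proof. by move=> h; apply/bigmax_leqP. Qed.

Lemma card_idx d n : #|{: idx (fun _ : 'I_d => n)}| = n ^ d.
Proof.
rewrite card_dep_ffun foldrE big_image /=.
rewrite (eq_bigr (fun=> n)) => [|i _]; last by rewrite card_ord.
by rewrite prod_nat_const card_ord.
Qed.

(** Sets that meet each row in at most one point are compared with this one,
    by projecting along the row. *)
Lemma card_bottom d n (l : 'I_d) :
  #|[set x : idx (fun _ : 'I_d => n) | x l == 0 :> nat]| <= n ^ (d - 1).
Proof.
pose D := [pred k : 'I_d | k != l].
have cD : #|D| = d - 1 by have := cardC1 l; rewrite card_ord subn1 => <-.
case: n => [|n].
  rewrite (_ : [set x | _] = set0) ?cards0 //.
  by apply/setP=> x; case: (x l).
pose F (k : 'I_d) := [pred a : 'I_n.+1 | (k != l) || (a == ord0)].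
have -> : #|[set x : idx (fun _ : 'I_d => n.+1) | x l == 0 :> nat]| = #|family F|.
  rewrite cardsE; apply: eq_card => x; rewrite !inE.
  apply/idP/familyP => [/eqP x0 k | /(_ l)].
    by rewrite inE; case: eqP => // ->; apply/eqP/val_inj.
  by rewrite inE eqxx /= => /eqP xl; apply/eqP; apply: (congr1 val xl).
rewrite card_family foldrE big_image /= (bigD1 l) //=.
rewrite (_ : #|F l| = 1) ?mul1n; last first.
  by rewrite -(card1 (@ord0 n)); apply: eq_card => a; rewrite !inE eqxx.
rewrite (eq_bigr (fun=> n.+1)) => [|k kl]; last first.
  by rewrite -[RHS]card_ord; apply: eq_card => a; rewrite !inE kl.
by rewrite prod_nat_const -cD.
Qed.

Lemma weight_le_expn d n (A : array (fun _ : 'I_d => n)) : weight A <= n ^ d.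
Proof. by rewrite -card_idx; apply: max_card. Qed.

(** The threshold in the asymptotic bound is absorbed by the constant, since an
    array of sidelength [n < n0] has at most [n0 * n ^ (d - 1)] entries. *)
Lemma ex_bigO_bound d (P : mat d) : 0 < d -> ex_bigO P ->
  exists K, forall n, extremal n P <= K * n ^ (d - 1).
Proof.
move=> d0 [C [n0 h]]; exists (C + n0) => n; rewrite mulnDl.
have [/h/leq_trans|lt] := leqP n0 n; first by apply; apply: leq_addr.
apply: extremal_le => A _; apply: leq_trans (weight_le_expn A) _.
apply: leq_trans (leq_addl _ _).
by rewrite -{1}(subnK d0) addn1 expnS leq_mul2r (ltnW lt) orbT.
Qed.

(** * From arrays to ordered hypergraphs *)

Lemma dense_colour d n (A : array (fun _ : 'I_d => n)) :
  exists b, n ^ d <= 2 * weight ([ffun x => A x == b] : array (fun=> n)).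
Proof.
have : n ^ d = weight ([ffun x => A x == true] : array (fun=> n)) +
               weight ([ffun x => A x == false] : array (fun=> n)).
  rewrite -card_idx -cardsT -(cardsID [set x | A x]) setTI; congr (_ + _).
    by apply: eq_card => x; rewrite !inE !ffunE eqb_id.
  by rewrite /weight; apply: eq_card => x; rewrite !inE !ffunE eqbF_neg andbT.
set s := weight _; set t := weight _ => nd.
by have [ts|/ltnW st] := leqP t s; [exists true | exists false];
  rewrite -/s -/t nd; lia.
Qed.

Lemma dense_contains d n (P : mat d) (A : array (fun _ : 'I_d => n)) :
  2 * extremal n P < n ^ d -> n ^ d <= 2 * weight A -> contains A P.
Proof.
move=> lt le; apply: contraT => /weight_le_extremal.
by rewrite leqNgt => /negP[]; rewrite -(ltn_pmul2l (isT : 0 < 2)); apply: leq_trans lt le.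
Qed.

(** Entry [x] of an array corresponds to the hyperedge that takes the [x i]-th
    vertex of the [i]-th interval of length [n]. *)
Lemma ramsey_of_arrays d (P : mat d) n :
  (forall A : array (fun _ : 'I_d => n),
     exists b, contains ([ffun x => A x == b] : array (fun=> n)) P) ->
  ramsey_property (hypergraph_of P) (d * n).
Proof.
move=> hA c.
have vlt (i : 'I_d) a : a < n -> i * n + a < d * n.
  move=> lta; apply: (@leq_trans (i.+1 * n)); last by rewrite leq_mul2r ltn_ord orbT.
  by rewrite mulSn addnC ltn_add2r.
pose V (i : 'I_d) (a : 'I_n) : 'I_(d * n) := Ordinal (vlt i a (ltn_ord a)).
have V_inj i j a b : V i a = V j b -> i = j.
  move=> /(congr1 val) /= eqv; apply/val_inj => /=.
  have := congr1 (divn^~ n) eqv.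
  have n0 : 0 < n := leq_ltn_trans (leq0n a) (ltn_ord a).
  by rewrite /= !divnMDl // !divn_small ?addn0.
pose e (x : idx (fun _ : 'I_d => n)) : {set 'I_(d * n)} := [set V i (x i) | i : 'I_d].
have ecard x : #|e x| = d.
  by rewrite card_imset ?card_ord // => i j /V_inj.
have [b cPb] := hA [ffun x => c (e x)]; exists b.
have /containsP[f [incf ltf fP]] := cPb.
pose g (v : 'I_(\sum_(i < d) side P i)) : 'I_(d * n) :=
  Ordinal (vlt (tagnat.sig1 v) _ (ltf _ _ (ltn_ord (tagnat.sig2 v)))).
exists (finfun g) => /=.
  apply/forallP=> v; apply/forallP=> w; apply/implyP=> ltvw; rewrite !ffunE /=.
  have := @tagnat.le_sig1 _ (side P) v w (ltnW ltvw); rewrite leEord leq_eqVlt.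
  case/orP=> [/eqP/val_inj eqi | lti]; last first.
    apply: leq_trans (leq_addr _ _).
    apply: (@leq_trans ((tagnat.sig1 v).+1 * n)); last by rewrite leq_mul2r lti orbT.
    by rewrite mulSn addnC ltn_add2r ltf.
  move: ltvw; rewrite -{1}(tagnat.sig2K v) -{1}(tagnat.sig2K w) !tagnat.RankEsum.
  move: (tagnat.sig2 v) (tagnat.sig2 w); rewrite -eqi => a a'.
  by rewrite ltn_add2l => ltaa; rewrite ltn_add2l; apply: incf.
move=> E /imsetP[x]; rewrite inE => Px ->.
have := fP (pos x); rewrite entry_pos => /(_ Px) /entryP[y /= Ay yE].
rewrite (_ : _ @: _ = e y) ?inE ?ecard ?eqxx /=; last first.
  rewrite /hyperedge -imset_comp; apply: eq_imset => i /=.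
  apply/val_inj; rewrite !ffunE /= (congr1 (fun h => h i) yE : y i = _ :> nat) /pos.
  by rewrite tagnat.Rank2K /= tagnat.Rank1K.
by move: Ay; rewrite !ffunE.
Qed.

Lemma ramsey_ge_nvert d (G : ohypergraph d) N :
  ramsey_property G N -> nvert G <= N.
Proof.
move=> /(_ (fun=> true))[b [f /forallP incf _]].
rewrite -[nvert G]card_ord -[N]card_ord; apply: (@leq_card _ _ f) => x y fxy.
have h (a a' : 'I_(nvert G)) : a < a' -> f a < f a'.
  by move=> lt; have /forallP/(_ a')/implyP := incf a; apply.
have [/h|/h|/val_inj //] := ltngtP x y; by rewrite fxy ltnn.
Qed.

Lemma linear_of_upper d (F : nat -> mat d) C :
  (forall j, 1 <= j -> exists2 N, ramsey_property (hypergraph_of (F j)) N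
     & N <= C * nvert (hypergraph_of (F j))) ->
  linear_ramsey (fun j => hypergraph_of (F j)).
Proof.
move=> h; exists C.+1 => j /h[N hN leN].
have hex : exists m, `[< ramsey_property (hypergraph_of (F j)) m >].
  by exists N; apply/asboolP.
case: (ex_minnP hex) => r /asboolP hr minr; exists r; split.
- by split=> // m /asboolP/minr.
- apply: leq_trans (minr N _) _; first exact/asboolP.
  by apply: leq_trans leN _; rewrite mulSn leq_addl.
- by apply: leq_trans (ramsey_ge_nvert hr) _; rewrite mulSn leq_addr.
Qed.

(** The sidelength [2 * K * j + 1] is the least one for which half of the
    entries outnumber the given bound. *)
Lemma linear_of_extremal d (F : nat -> mat d) K : 0 < d ->
  (forall j n, 1 <= j -> extremal n (F j) <= K * j * n ^ (d - 1)) ->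
  (forall j, 1 <= j -> j <= nvert (hypergraph_of (F j))) ->
  linear_ramsey (fun j => hypergraph_of (F j)).
Proof.
move=> d0 hex hv; apply: (@linear_of_upper _ _ (d * (2 * K).+1)) => j j1.
pose n := (2 * K * j).+1; exists (d * n).
  apply: ramsey_of_arrays => A; have [b Ab] := dense_colour A; exists b.
  apply: dense_contains Ab; apply: (@leq_ltn_trans (2 * (K * j * n ^ (d - 1)))).
    by rewrite leq_mul2l hex.
  by rewrite -{2}(subnK d0) addn1 expnS mulnA ltn_pmul2r ?expn_gt0 // /n mulnA.
have := hv j j1; set v := nvert _ => jv.
by rewrite -mulnA leq_mul2l; apply/orP; right; rewrite /n; nia.
Qed.

(** With at most one hyperedge, the colour of that hyperedge is the right one
    and the identity is a copy. *)
Lemma ramsey_few_ones d (P : mat d) :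
  (forall x y, P x -> P y -> x = y) ->
  ramsey_property (hypergraph_of P) (nvert (hypergraph_of P)).
Proof.
move=> one c; set G := hypergraph_of P.
have idE (e : {set 'I_(nvert G)}) : [ffun x => x] @: e = e.
  by rewrite -[RHS]imset_id; apply: eq_imset => x; rewrite ffunE.
have incid : increasing [ffun x : 'I_(nvert G) => x].
  by apply/forallP=> a; apply/forallP=> b; rewrite !ffunE; apply/implyP.
have [[x Px]|no] := EM (exists x, P x).
  exists (c (hyperedge x)), [ffun x => x] => //= e /[dup] eG.
  move=> /imsetP[y]; rewrite inE => Py ee; rewrite idE inE (mat_edges_uniform eG).
  by rewrite ee (one x y) // !eqxx.
exists true, [ffun x => x] => //= e /imsetP[y]; rewrite inE => Py _.
by case: no; exists y.
Qed.

Lemma le1_few_ones d (P : mat d) : (forall i, side P i <= 1) ->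
  forall x y, P x -> P y -> x = y.
Proof.
move=> h x y _ _; apply: pos_inj; apply: funext => i; rewrite /pos.
have h0 (z : idx (side P)) : z i = 0 :> nat.
  by apply/eqP; rewrite -leqn0 -ltnS (leq_trans (ltn_ord _) (h i)).
by rewrite !h0.
Qed.

(** * Prolonging copies *)

Lemma copy_sub d (n : 'I_d -> nat) (A A' : array n) (P : mat d) f :
  (forall x, A' x -> A x) -> copy A' P f -> copy A P f.
Proof.
move=> sub [incf ltf fP]; split=> // u /fP/entryP[x /sub Ax xu].
by apply/entryP; exists x.
Qed.

Lemma copy_leq d (n : 'I_d -> nat) (A : array n) (P : mat d) f i a b :
  copy A P f -> a <= b -> b < side P i -> f i a <= f i b.
Proof.
case=> incf _ _; rewrite leq_eqVlt => /orP[/eqP-> // | ltab ltb].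
exact/ltnW/incf.
Qed.

Definition upd d (u : 'I_d -> nat) (i : 'I_d) (c : nat) : 'I_d -> nat :=
  fun k => if k == i then c else u k.

Lemma upd_same d (u : 'I_d -> nat) i c : upd u i c i = c.
Proof. by rewrite /upd eqxx. Qed.

Lemma upd_id d (u : 'I_d -> nat) i : upd u i (u i) = u.
Proof. by apply: funext => k; rewrite /upd; case: eqP => // ->. Qed.

Lemma upd_upd d (u : 'I_d -> nat) i b c : upd (upd u i b) i c = upd u i c.
Proof. by apply: funext => k; rewrite /upd; case: eqP. Qed.

Lemma updC d (u : 'I_d -> nat) i l b c : i != l ->
  upd (upd u i b) l c = upd (upd u l c) i b.
Proof.
move=> il; apply: funext => k; rewrite /upd.
by case: (eqVneq k l) => // ->; rewrite eq_sym (negbTE il).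
Qed.

Lemma same_rowP d (i : 'I_d) (u w : 'I_d -> nat) :
  reflect (w = upd u i (w i)) (same_row i u w).
Proof.
apply: (iffP forallP) => [h | -> k].
  apply: funext => k; rewrite /upd; case: eqVneq => [-> // | ki].
  by apply/eqP; have /implyP := h k; apply.
by rewrite /upd; apply/implyP => /negbTE->.
Qed.

Arguments same_rowP {d i u w}.

(** [h] gives the positions, in the ambient array, of the [m] planes that are
    inserted in dimension [i] at [p]. *)
Definition insert_map d (i : 'I_d) (p m : nat) (h : nat -> nat)
    (f : 'I_d -> nat -> nat) : 'I_d -> nat -> nat :=
  fun k a => if k == i then
               if a < p then f i a
               else if a < p + m then h (a - p) else f i (a - m)
             else f k a.

Lemma copy_insert d (n : 'I_d -> nat) (A : array n) (P : mat d) f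
    (i : 'I_d) (p m : nat) (h : nat -> nat) (B : ('I_d -> nat) -> bool) :
  copy A P f -> p <= side P i ->
  (forall a b, a < b -> b < m -> h a < h b) ->
  (forall t, t < m -> h t < n i) ->
  (forall a t, a < p -> t < m -> f i a < h t) ->
  (forall a t, p <= a -> a < side P i -> t < m -> h t < f i a) ->
  (forall w, B w -> (forall k, k != i -> w k < side P k) -> p <= w i < p + m ->
     entry (Mat A) (upd (fun k => f k (w k)) i (h (w i - p)))) ->
  copy A (insert_planes i p m B P) (insert_map i p m h f).
Proof.
move=> [incf ltf fP] lep inch lth fh hf hB; split=> [k a b | k a | w].
- rewrite /= /insert_map; case: (eqVneq k i) => [-> | _]; last exact: incf.
  move=> ltab ltb.
  case: (ltnP a p) => ap; case: (ltnP b p) => bp; try lia.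
  + by apply: incf => //; lia.
  + case: (ltnP b (p + m)) => bm; first by apply: fh => //; lia.
    by apply: incf; lia.
  + case: (ltnP a (p + m)) => am; case: (ltnP b (p + m)) => bm; try lia.
    * by apply: inch; lia.
    * by apply: hf; lia.
    * by apply: incf; lia.
- rewrite /= /insert_map; case: (eqVneq k i) => [-> | _]; last exact: ltf.
  move=> lta; case: (ltnP a p) => ap; first by apply: ltf; lia.
  by case: (ltnP a (p + m)) => am; [apply: lth | apply: ltf]; lia.
rewrite entry_build => /andP[/forallP /= bw].
have bwk k : k != i -> w k < side P k by move=> ki; have := bw k; rewrite (negbTE ki).
case: ifP => wp.
  move=> /fP; congr (is_true (entry _ _)); apply: funext => k; rewrite /insert_map.
  by case: eqVneq => // ->; rewrite wp.
case: ifP => wpm.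
  move=> Bw; have := hB w Bw bwk; rewrite leqNgt wp wpm => /(_ isT).
  congr (is_true (entry _ _)); apply: funext => k; rewrite /insert_map /upd.
  by case: eqVneq => // ->; rewrite wp wpm.
move=> /fP; congr (is_true (entry _ _)); apply: funext => k; rewrite /insert_map.
by case: eqVneq => // ->; rewrite wp wpm.
Qed.

Lemma nvert_insert d (i : 'I_d) p m B (P : mat d) :
  nvert (hypergraph_of (insert_planes i p m B P)) = nvert (hypergraph_of P) + m.
Proof.
rewrite /= (bigD1 i) //= eqxx [in RHS](bigD1 i) //= addnAC; congr (_ + _ + _).
by apply: eq_bigr => k /negbTE->.
Qed.

Lemma weight_split d (n : 'I_d -> nat) (A : array n) (q : pred (idx n)) :
  weight A = weight [ffun x => A x && ~~ q x] + #|[set x | A x && q x]|.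
Proof.
rewrite /weight -(cardsID [set x | q x] [set x | A x]) addnC; congr (_ + _).
  by apply: eq_card => x; rewrite !inE ffunE andbC.
by apply: eq_card => x; rewrite !inE.
Qed.

(** * New end planes *)

Lemma card_row_transversal d n (i : 'I_d) (T : {set idx (fun _ : 'I_d => n)}) :
  {in T &, forall x y, same_row i (pos x) (pos y) -> x = y} ->
  #|T| <= n ^ (d - 1).
Proof.
move=> hT; apply: leq_trans (card_bottom n i).
pose g (x : idx (fun _ : 'I_d => n)) := mkidx x (upd (pos x) i 0).
have gE x : pos (g x) = upd (pos x) i 0.
  apply: mkidxK => k; rewrite /upd; case: eqP => _; last exact: ltn_ord.
  exact: leq_ltn_trans (leq0n (x i)) (ltn_ord _).
rewrite -(@card_in_imset _ _ g T) => [|x y xT yT gxy]; last first.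
  apply: hT => //; apply/same_rowP.
  by rewrite -(upd_upd (pos x) i 0) -gE gxy gE upd_upd upd_id.
apply: subset_leq_card; apply/subsetP=> _ /imsetP[x _ ->]; rewrite inE.
by have := congr1 (fun h => h i) (gE x); rewrite /pos upd_same => ->.
Qed.

(** Delete from each [i]-row its extreme one in the direction [r].  If [Q] is
    contained in what remains, at [f], then beyond the image of the one [u]
    there is a further one [z] of the same row. *)
Lemma extremal_remove_extreme d n (i : 'I_d) (r : rel nat) (u : 'I_d -> nat)
    (Q Q' : mat d) :
  (forall a b, a != b -> r a b || r b a) -> entry Q u ->
  (forall (A : array (fun _ => n)) f z, copy A Q f -> entry (Mat A) z ->
     z = upd (fun k => f k (u k)) i (z i) -> r (z i) (f i (u i)) ->
     contains A Q') ->
  extremal n Q' <= extremal n Q + n ^ (d - 1).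
Proof.
move=> rtot Qu hQ; apply: extremal_le => A nA.
pose q (x : idx (fun _ : 'I_d => n)) :=
  ~~ [exists z, [&& A z, same_row i (pos x) (pos z) & r (z i) (x i)]].
rewrite (weight_split A q); apply: leq_add; last first.
  apply: (card_row_transversal (i := i)) => x y; rewrite !inE.
  move=> /andP[Ax /existsPn qx] /andP[Ay /existsPn qy] xy.
  have yx : same_row i (pos y) (pos x).
    by apply/same_rowP; rewrite (same_rowP xy) /= upd_upd upd_id.
  apply: pos_inj; rewrite (same_rowP xy) /=.
  suff -> : pos y i = pos x i by rewrite upd_id.
  apply/eqP; apply: contraT => /rtot.
  by have := qx y; have := qy x; rewrite Ax Ay xy yx /= /pos => /negbTE-> /negbTE->.
apply: weight_le_extremal; apply: contra nA => /containsP[f cf].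
have [_ _ /(_ _ Qu)/entryP[x]] := cf; rewrite ffunE negbK /= => /andP[Ax] qx xE.
have /existsP[z /and3P[Az xz rz]] := qx.
apply: (hQ A f (pos z)); first by apply: copy_sub cf => y; rewrite ffunE => /andP[].
- by rewrite entry_pos.
- by rewrite -xE; apply/same_rowP.
- by rewrite -[f i _](congr1 (fun g => g i) xE).
Qed.

Lemma extremal_first_plane d n (i : 'I_d) (Q : mat d) u :
  entry Q u -> u i = 0 ->
  extremal n (insert_planes i 0 1 (same_row i u) Q) <=
  extremal n Q + n ^ (d - 1).
Proof.
move=> Qu ui; apply: (@extremal_remove_extreme _ _ i ltn u) => // [a b|A f z cf Az zE].
  by rewrite neq_ltn.
rewrite /= ui => rz; apply/containsP; exists (insert_map i 0 1 (fun=> z i) f).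
have zn t : t < 1 -> z i < n by move=> _; have := entry_lt i Az.
apply: copy_insert => //.
- by move=> a b ab; rewrite ltnS leqn0 => /eqP b0; move: ab; rewrite b0.
- by move=> a t _ alt _; apply: leq_trans rz _; apply: copy_leq cf _ alt.
move=> w /same_rowP -> _ _; rewrite [X in entry _ X](_ : _ = z) // [RHS]zE.
by apply: funext => k; rewrite /upd; case: eqP.
Qed.

Lemma extremal_last_plane d n (i : 'I_d) (Q : mat d) u :
  entry Q u -> (u i).+1 = side Q i ->
  extremal n (insert_planes i (side Q i) 1 (same_row i u) Q) <=
  extremal n Q + n ^ (d - 1).
Proof.
move=> Qu ui; apply: (@extremal_remove_extreme _ _ i (fun a b => b < a) u) => //
   [a b|A f z cf Az zE].
  by rewrite orbC neq_ltn.
move=> rz; apply/containsP; exists (insert_map i (side Q i) 1 (fun=> z i) f).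
have zn t : t < 1 -> z i < n by move=> _; have := entry_lt i Az.
apply: copy_insert => //.
- by move=> a b ab; rewrite ltnS leqn0 => /eqP b0; move: ab; rewrite b0.
- move=> a t alt _; apply: leq_ltn_trans _ rz; apply: copy_leq cf _ _ => //.
    by rewrite -ltnS ui.
  by rewrite -ui.
- by move=> a t; rewrite leqNgt => /negP.
move=> w /same_rowP -> _ _; rewrite [X in entry _ X](_ : _ = z) // [RHS]zE.
by apply: funext => k; rewrite /upd; case: eqP.
Qed.

(** * Stretching a row *)

Lemma count_nth_between (R : pred nat) a b j :
  a <= b -> j <= count R (iota a (b - a)) ->
  exists h : nat -> nat, [/\ forall s t, s < t -> t < j -> h s < h t,
    forall t, t < j -> R (h t) & forall t, t < j -> a <= h t < b].
Proof.
move=> ab jle; pose s := filter R (iota a (b - a)).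
have sz : j <= size s by rewrite size_filter.
have inS t : t < j -> nth 0 s t \in s by move=> tj; apply/mem_nth/leq_trans/sz.
exists (nth 0 s); split=> [t t' tt' t'j | t /inS | t /inS].
- apply: (sorted_ltn_nth ltn_trans) => //; rewrite ?inE; try lia.
  by apply: sorted_filter (iota_ltn_sorted _ _); apply: ltn_trans.
- by rewrite mem_filter => /andP[].
- by rewrite mem_filter mem_iota subnKC // => /andP[].
Qed.

(** Let [A] avoid the stretched matrix.  Then the ones of [A] with a given rank
    modulo [j + 1] in their [i]-row contain no [P]: two such ones in one row are
    at least [j + 1] ranks apart, so [j] ones of [A] are available between
    them. *)
Lemma extremal_row_stretch d n (i : 'I_d) (P : mat d) u j
    (B : ('I_d -> nat) -> bool) :
  entry P u -> entry P (upd u i (u i).+1) ->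
  (forall w, B w -> same_row i u w) ->
  extremal n (insert_planes i (u i).+1 j B P) <= j.+1 * extremal n P.
Proof.
move=> Pu Pv hB; apply: extremal_le => A nA.
pose R (w : 'I_d -> nat) c := entry (Mat A) (upd w i c).
pose rk (w : 'I_d -> nat) := count (R w) (iota 0 (w i)).
pose Ac (c : 'I_j.+1) : array (fun _ : 'I_d => n) :=
  [ffun x => A x && (rk (pos x) %% j.+1 == c)].
have -> : weight A = \sum_(c < j.+1) weight (Ac c).
  rewrite /weight -sum1_card.
  rewrite (partition_big (fun x => inord (rk (pos x) %% j.+1) : 'I_j.+1) predT) //=.
  apply: eq_bigr => c _; rewrite -sum1_card; apply: eq_bigl => x.
  rewrite !inE ffunE; case: (A x) => //=.
  by rewrite -val_eqE /= inordK // ltn_mod.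
rewrite -[j.+1 in X in _ <= X]card_ord -sum_nat_const; apply: leq_sum => c _.
apply: weight_le_extremal; apply: contra nA => /containsP[f cf].
have [_ _ fP] := cf.
have /entryP[x] := fP _ Pu; rewrite ffunE /= => /andP[Ax /eqP rx] xE.
have /entryP[y] := fP _ Pv; rewrite ffunE /= => /andP[Ay /eqP ry] yE.
have sub : copy A P f by apply: copy_sub cf => z; rewrite ffunE => /andP[].
have xy : pos y = upd (pos x) i (pos y i).
  by rewrite xE yE; apply: funext => k; rewrite /upd; case: eqVneq => // ->; rewrite eqxx.
have ltP : (u i).+1 < side P i by have := entry_lt i Pv; rewrite upd_same.
have xi : pos x i = f i (u i) by rewrite xE.
have yi : pos y i = f i (u i).+1 by rewrite yE upd_same.
have ltxy : pos x i < pos y i by rewrite xi yi; case: sub => inc _ _; apply: inc.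
have [|h [inch hR hb]] := @count_nth_between (R (pos x)) (pos x i).+1 (pos y i) j ltxy.
  have RE : R (pos y) = R (pos x).
    by apply: funext => t; rewrite /R xy upd_upd.
  (* The ranks differ by a positive multiple of [j + 1], and the one at [x] is
     counted in the difference. *)
  have E : rk (pos y) = rk (pos x) + (1 + count (R (pos x))
      (iota (pos x i).+1 (pos y i - (pos x i).+1))).
    have e1 : iota 0 (pos y i) = iota 0 (pos x i) ++ pos x i ::
        iota (pos x i).+1 (pos y i - (pos x i).+1).
      rewrite -[_ :: _]/(iota (pos x i) (_.+1)) -iotaD; congr iota; lia.
    rewrite /rk RE e1 count_cat /= /R upd_id entry_pos.
    by rewrite (Ax : entries (Mat A) x = true).
  move: ry; rewrite E -rx => /eqP; rewrite eq_sym -{1}[rk (pos x)]addn0 eqn_modDl mod0n.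
  by rewrite eq_sym add1n => /(dvdn_leq (ltn0Sn _)).
apply/containsP; exists (insert_map i (u i).+1 j h f).
apply: copy_insert sub _ _ _ _ _ _ => //.
- exact: ltnW.
- by move=> t /hb /andP[_ /leq_trans]; apply; apply/ltnW/(ltn_ord (y i)).
- move=> a t au /hb /andP[lt _]; apply: leq_ltn_trans lt; rewrite xi.
  by apply: copy_leq cf _ _ => //; apply: ltnW.
- move=> a t ua alt /hb /andP[_ lt]; apply: leq_trans lt _; rewrite yi.
  exact: copy_leq cf _ _.
move=> w Bw _ /andP[l1 l2].
have := hR (w i - (u i).+1); rewrite ltn_subLR // => /(_ l2); rewrite /R xE.
congr (is_true (entry _ _)); apply: funext => k; rewrite (same_rowP (hB w Bw)) /upd.
by case: eqP.
Qed.

(** * Gluing at a corner *)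

Lemma copy_glue d (n : 'I_d -> nat) (A : array n) (s : 'I_d -> bool)
    (Q P : mat d) g f :
  copy A Q g -> copy A P f ->
  (forall k, 0 < side Q k) -> (forall k, 0 < side P k) ->
  (forall k, f k (corner (side P) s k) = g k (corner (side Q) (fun i => ~~ s i) k)) ->
  contains A (glue s Q P).
Proof.
move=> [incg ltg gQ] [incf ltf fP] Q0 P0 fg; apply/containsP.
exists (fun k a => if s k then if a < side Q k then g k a else f k (a - (side Q k).-1)
                   else if a < side P k then f k a else g k (a - (side P k).-1)).
have fg' k : if s k then f k 0 = g k (side Q k).-1 else f k (side P k).-1 = g k 0.
  by have := fg k; rewrite /corner; case: (s k).
split=> [k a b | k a | w].
- have := fg' k; have := Q0 k; have := P0 k; rewrite /=.
  case: (s k) => P0k Q0k E ltab ltb.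
    case: (ltnP b (side Q k)) => bQ; case: (ltnP a (side Q k)) => aQ; try lia.
    + exact: incg.
    + have: g k a <= g k (side Q k).-1.
        have [->//|ne] := eqVneq a (side Q k).-1; apply/ltnW/incg; lia.
      by rewrite -E => /leq_ltn_trans; apply; apply: incf; lia.
    + by apply: incf; lia.
  case: (ltnP b (side P k)) => bP; case: (ltnP a (side P k)) => aP; try lia.
  + exact: incf.
  + have: f k a <= f k (side P k).-1.
      have [->//|ne] := eqVneq a (side P k).-1; apply/ltnW/incf; lia.
    by rewrite E => /leq_ltn_trans; apply; apply: incg; lia.
  + by apply: incg; lia.
- have := Q0 k; have := P0 k; rewrite /= => P0k Q0k lta.
  by case: (s k) => /=; [case: (ltnP a (side Q k)) => h | case: (ltnP a (side P k)) => h];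
    first [apply: ltf | apply: ltg]; lia.
rewrite entry_build => /andP[_ /orP[] /andP[/forallP off] ew].
  have := gQ _ ew; congr (is_true (entry _ _)); apply: funext => k.
  have := off k; have := entry_lt k ew; have := fg' k; have := Q0 k; have := P0 k.
  rewrite /=; case: (s k) => /= P0k Q0k E; first by rewrite subn0 => ->.
  case: (ltnP (w k) (side P k)) => // wP _ offk.
  have -> : w k = (side P k).-1 by lia.
  by rewrite subnn.
have := fP _ ew; congr (is_true (entry _ _)); apply: funext => k.
have := off k; have := entry_lt k ew; have := fg' k; have := Q0 k; have := P0 k.
rewrite /=; case: (s k) => /= P0k Q0k E; last by rewrite subn0 => ->.
case: (ltnP (w k) (side Q k)) => // wP _ offk.
have -> : w k = (side Q k).-1 by lia.
by rewrite subnn.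
Qed.

(** Let [A] avoid the glued matrix.  The predicate [q] marks the ones that are
    the corner [s] of a copy of [P]: the marked ones contain no [Q], because a
    copy of [P] starts at its free corner, and the others contain no [P]. *)
Lemma extremal_glue d n (s : 'I_d -> bool) (Q P : mat d) :
  entry Q (corner (side Q) (fun i => ~~ s i)) -> entry P (corner (side P) s) ->
  extremal n (glue s Q P) <= extremal n Q + extremal n P.
Proof.
move=> Qc Pc; apply: extremal_le => A nA.
pose q (x : idx (fun _ : 'I_d => n)) :=
  `[< exists2 f, copy A P f & pos x = fun k => f k (corner (side P) s k) >].
rewrite (weight_split A q) addnC; apply: leq_add.
  rewrite (_ : #|_| = weight ([ffun x => A x && q x] : array (fun=> n))); last first.
    by apply: eq_card => x; rewrite !inE ffunE.
  apply: weight_le_extremal; apply: contra nA => /containsP[g cg].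
  have [_ _ /(_ _ Qc)/entryP[x]] := cg.
  rewrite ffunE => /andP[Ax /asboolP[f cf xf]] xg.
  have cg' : copy A Q g by apply: copy_sub cg => z; rewrite ffunE => /andP[].
  apply: copy_glue cg' cf _ _ _ => k.
  - exact: leq_ltn_trans (leq0n _) (entry_lt k Qc).
  - exact: leq_ltn_trans (leq0n _) (entry_lt k Pc).
  - by rewrite -[LHS](congr1 (fun h => h k) xf) (congr1 (fun h => h k) xg).
apply: weight_le_extremal; apply/negP => /containsP[f cf].
have [_ _ /(_ _ Pc)/entryP[x]] := cf; rewrite ffunE => /andP[Ax /negP nq] xf; apply: nq.
by apply/asboolP; exists f => //; apply: copy_sub cf => z; rewrite ffunE => /andP[].
Qed.

(** The corner where the next copy is attached comes from the copy of [P] that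
    was added last. *)
Lemma glue_corner d (s : 'I_d -> bool) (Q P : mat d) :
  entry Q (corner (side Q) (fun i => ~~ s i)) ->
  entry P (corner (side P) (fun i => ~~ s i)) ->
  entry (glue s Q P) (corner (side (glue s Q P)) (fun i => ~~ s i)).
Proof.
move=> Qc Pc; rewrite entry_build.
have Q0 k : 0 < side Q k by exact: leq_ltn_trans (leq0n _) (entry_lt k Qc).
have P0 k : 0 < side P k by exact: leq_ltn_trans (leq0n _) (entry_lt k Pc).
apply/andP; split.
  apply/forallP=> k; rewrite /corner /=; have := Q0 k; have := P0 k.
  by case: (s k) => /=; lia.
apply/orP; right; apply/andP; split.
  apply/forallP=> k; rewrite /corner /=; have := Q0 k; have := P0 k.
  by case: (s k) => /=; lia.
move: Pc; congr (is_true (entry _ _)); apply: funext => k.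
rewrite /corner /=; have := Q0 k; have := P0 k.
by case: (s k) => /=; lia.
Qed.

(** * Spreading *)

(** The sub-array of entries whose coordinates are multiples of [j + 1] has
    sidelength [m] and contains [P] in one colour.  In the large array the
    planes of that copy are at distance at least [j + 1], which leaves room for
    the empty planes. *)
Lemma ramsey_spread d (P : mat d) j m : 2 * extremal m P < m ^ d ->
  ramsey_property (hypergraph_of (spread j P)) (d * (m * j.+1)).
Proof.
move=> hm; apply: ramsey_of_arrays => A.
pose A0 : array (fun _ : 'I_d => m) :=
  [ffun x : idx (fun=> m) => entry (Mat A) (fun i => x i * j.+1)].
have [b Ab] := dense_colour A0; exists b.
have /containsP[f [incf ltf fP]] := dense_contains hm Ab; apply/containsP.
have qlt i a : a < side P i + (side P i).-1 * j -> a %/ j.+1 < side P i.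
  by move=> lta; rewrite ltn_divLR //; move: lta; case: (side P i); lia.
exists (fun i a => f i (a %/ j.+1) * j.+1 + a %% j.+1); split=> [i a b' | i a | w].
- rewrite /= => ltab ltb; have := leq_div2r j.+1 (ltnW ltab).
  rewrite leq_eqVlt => /orP[/eqP E | lt].
    by rewrite E ltn_add2l; move: ltab; rewrite {1}(divn_eq a j.+1) {1}(divn_eq b' j.+1) E ltn_add2l.
  have := incf i _ _ lt (qlt _ _ ltb); have := ltn_pmod a (ltn0Sn j).
  by move: (f i _) (f i _) (a %% _) (b' %% _) => *; nia.
- rewrite /= => /qlt/ltf; have := ltn_pmod a (ltn0Sn j).
  by move: (f i _) (a %% _) => *; nia.
rewrite entry_build => /andP[_ /andP[/forallP dv /fP/entryP[x]]].
rewrite !ffunE => /= Ax xE.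
have wE : (fun i => f i (w i %/ j.+1) * j.+1 + w i %% j.+1) = (fun i => x i * j.+1).
  apply: funext => i; rewrite (eqP (dv i)) addn0.
  by rewrite -[f i _](congr1 (fun h => h i) xE).
have lt i : x i * j.+1 < m * j.+1 by rewrite ltn_pmul2r.
have [y yE] := idx_of (n := fun=> m * j.+1) lt.
apply/entryP; exists y; last by rewrite wE.
by rewrite ffunE -[A y](@entry_pos _ (Mat A)) yE.
Qed.

(** * The planar charging argument *)

(** The selection goes from left to right, so that a rejected column is blocked
    by an earlier selected one ([kept_blocked]), while any two selected columns
    are in relation [g] ([kept_rel]). *)
Fixpoint greedy (R : pred nat) (g : rel nat) (n : nat) : seq nat :=
  if n is c.+1 then
    if R c && all (fun a => g a c) (greedy R g c) then c :: greedy R g c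
    else greedy R g c
  else [::].

Definition kept (R : pred nat) (g : rel nat) c := c \in greedy R g c.+1.

Lemma mem_greedy (R : pred nat) (g : rel nat) n c :
  (c \in greedy R g n) = (c < n) && kept R g c.
Proof.
elim: n => [|n IH] //=; have [->|nc] := eqVneq c n.
  by rewrite ltnSn.
rewrite ltnS leq_eqVlt (negbTE nc) /= -IH.
by case: ifP => // _; rewrite inE (negbTE nc).
Qed.

Lemma keptE (R : pred nat) (g : rel nat) c :
  kept R g c = R c && all (fun a => g a c) (greedy R g c).
Proof.
by rewrite /kept /=; case: ifP => h; rewrite ?inE ?eqxx // mem_greedy ltnn.
Qed.

Lemma kept_one (R : pred nat) (g : rel nat) c : kept R g c -> R c.
Proof. by rewrite keptE => /andP[]. Qed.

Lemma kept_rel (R : pred nat) (g : rel nat) a c :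
  kept R g a -> kept R g c -> a < c -> g a c.
Proof.
rewrite [kept _ _ c]keptE => Ka /andP[_ /allP h] ac; apply: h.
by rewrite mem_greedy ac.
Qed.

Lemma kept_blocked (R : pred nat) (g : rel nat) c : R c -> ~~ kept R g c ->
  exists a, [/\ kept R g a, a < c & ~~ g a c].
Proof.
rewrite keptE => -> /= /allPn[a]; rewrite mem_greedy => /andP[ac Ka] ng.
by exists a.
Qed.

Section Planar.

Variables (n : nat) (M : rel nat).
Hypothesis M_bound : forall r c, M r c -> r < n /\ c < n.

(** Rows are numbered from the top: the witness [q] is above [r].  The columns
    [m1] and [m2] will carry the two ones of a new top plane. *)
Definition nested r a c : bool :=
  `[< exists q m1 m2, [/\ q < r, a < m1, m1 < m2, m2 < c & M q m1 /\ M q m2] >].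

Definition keep r c := kept (M r) (nested r) c.

(** A number [x] stands for the boundary between columns [x] and [x.+1].  The
    ones of row [r] strictly between a kept one [a] and a one [w] with
    [~~ nested r a w] form a segment, in which every row above has at most
    one one.  Row [r] closes the boundaries between the ones of the segment:
    no row above could tell the columns of the segment apart if they were
    merged into one. *)
Definition closes r x : Prop := exists a u v w,
  [/\ keep r a, ~~ nested r a w, [/\ M r u, M r v & M r w],
      a < u <= x & x < v < w].

Lemma nested_mono r a a' c c' : a' <= a -> c <= c' -> nested r a c -> nested r a' c'.
Proof.
move=> aa cc /asboolP[q [m1 [m2 [qr am mm mc [M1 M2]]]]]; apply/asboolP.
by exists q, m1, m2; split=> //; [apply: leq_ltn_trans am | apply: leq_trans cc].
Qed.

Lemma first_after (R : pred nat) a u : R u -> a < u ->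
  exists u0, [/\ R u0, a < u0 & forall b, R b -> a < b -> u0 <= b].
Proof.
move=> Ru au; have ex : exists b, R b && (a < b) by exists u; rewrite Ru.
case: (ex_minnP ex) => u0 /andP[Ru0 au0] h; exists u0; split=> // b Rb ab.
by apply: h; rewrite Rb.
Qed.

Lemma last_before (R : pred nat) c v : R v -> v < c ->
  exists v0, [/\ R v0, v0 < c & forall b, R b -> b < c -> b <= v0].
Proof.
move=> Rv vc; have ex : exists b, R b && (b < c) by exists v; rewrite Rv.
have ub b : R b && (b < c) -> b <= c by move=> /andP[_ /ltnW].
case: (ex_maxnP ex ub) => v0 /andP[Rv0 v0c] h; exists v0; split=> // b Rb bc.
by apply: h; rewrite Rb.
Qed.

Lemma keep_nested r a c : keep r a -> keep r c -> a < c -> nested r a c.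
Proof. exact: kept_rel. Qed.

(** After merging columns across all boundaries closed by the rows below row
    [r], the ones of each row [q <= r] still lie in distinct columns.  The proof
    goes from the bottom row up.  Suppose row [r + 1] closes an open boundary
    [x] between two ones [b] and [b'] of row [q], through a segment that starts
    after the kept one [a], and let [w0] be the last one with
    [~~ nested a w0].  If both [b] and [b'] are strictly between [a] and [w0],
    they witness [nested a w0].  Otherwise the interval from [b] to [b'] covers
    the gap from [a] to the first one of the segment, or the gap before [w0];
    row [r + 1] closes no boundary in these two gaps, and the induction
    hypothesis, applied to row [r + 1] itself, finds an open one there. *)
Lemma open_boundary r q b b' : q <= r -> M q b -> M q b' -> b < b' ->
  exists2 x, b <= x < b' & forall r', r < r' -> ~ closes r' x.
Proof.
have [m] := ubnP (n - r); elim: m r q b b' => // m IH r q b b' ltm qr Mb Mb' bb'.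
have [nr|rn] := leqP n r.
  exists b; first by rewrite leqnn.
  move=> r' rr' [a [u [v [w [_ _ [/M_bound[r'n _] _ _] _ _]]]]]; lia.
have IHr := IH r.+1 _ _ _ ltac:(lia).
have combine y z x : y <= x < z -> b <= y -> z <= b' ->
    (forall r', r.+1 < r' -> ~ closes r' x) -> ~ closes r.+1 x ->
    exists2 x, b <= x < b' & forall r', r < r' -> ~ closes r' x.
  move=> yxz hy hz hx hr; exists x => [|r']; first lia.
  by rewrite leq_eqVlt => /orP[/eqP <- | /hx].
have [x /andP[bx xb'] hx] := IHr q b b' (leqW qr) Mb Mb' bb'.
have [[a [u [v [w [Ka ng [Mu Mv Mw] /andP[au ux] /andP[xv vw]]]]]]|nc] := EM (closes r.+1 x); last first.
  by apply: (combine b b' x) => //; rewrite bx.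
have Ma : M r.+1 a := kept_one Ka.
have [u0 [Mu0 au0 u0min]] := @first_after (M r.+1) a u Mu au.
have [ba|ab] := leqP b a.
  have [y /andP[ay yu] hy] := IHr _ _ _ (leqnn _) Ma Mu0 au0.
  apply: (combine a u0 y) => //; rewrite ?ay //.
    by have := u0min u Mu au; clear -ux xb'; lia.
  move=> [a' [u' [v' [w' [Ka' ng' [Mu' Mv' Mw'] /andP[au' uy'] /andP[yv' vw']]]]]].
  have [aa|aa|aa] := ltngtP a a'.
  - have Ma' : M r.+1 a' := kept_one Ka'.
    have u0a' := u0min a' Ma' aa.
    by clear -uy' au' yu u0a'; lia.
  - have /negP[] := ng'; apply: nested_mono (keep_nested Ka' Ka aa) => //.
    by clear -ay yv' vw'; lia.
  - rewrite -aa in au'; have := u0min u' Mu' au'.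
    by clear -uy' yu; lia.
have exw : exists t, M r.+1 t && ~~ nested r.+1 a t by exists w; rewrite Mw.
have ubw t : M r.+1 t && ~~ nested r.+1 a t -> t <= n.
  by move=> /andP[/M_bound[_ /ltnW]].
case: (ex_maxnP exw ubw) => w0 /andP[Mw0 ng0] w0max.
have ww0 : w <= w0 by apply: w0max; rewrite Mw.
have [v0 [Mv0 v0w0 v0max]] := @last_before (M r.+1) w0 v Mv (leq_trans vw ww0).
have [wb|bw] := leqP w0 b'.
  have [y /andP[vy yw] hy] := IHr _ _ _ (leqnn _) Mv0 Mw0 v0w0.
  have vv0 : v <= v0 := v0max v Mv (leq_trans vw ww0).
  apply: (combine v0 w0 y) => //; rewrite ?vy //; first by clear -bx xv vv0; lia.
  move=> [a' [u' [v' [w' [Ka' ng' [Mu' Mv' Mw'] /andP[au' uy'] /andP[yv' vw']]]]]].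
  have [aa|aa|aa] := ltngtP a a'.
  - have /negP[] := ng0; apply: nested_mono (keep_nested Ka Ka' aa) => //.
    by clear -au' uy' yw; lia.
  - have /negP[] := ng'; apply: nested_mono (keep_nested Ka' Ka aa) => //.
    have := v0max a (kept_one Ka) (ltn_trans au (leq_ltn_trans ux (ltn_trans xv (leq_trans vw ww0)))).
    by clear -vy yv' vw'; lia.
  - have := w0max w'; rewrite Mw' aa ng' => /(_ isT) w'w.
    have := v0max v' Mv' (leq_trans vw' w'w).
    by clear -vy yv'; lia.
have /negP[] := ng0; apply/asboolP; exists q, b, b'; split=> //.
Qed.

(** The deleted ones of a row form runs, each blocked by the kept one that
    precedes it.  The first and the last one of a run (types 0 and 1) are
    charged to that kept one [s].  Any other one (type 2) is charged to a
    boundary [s] which lies between [c] and the preceding one [p] of the row and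
    is not closed by lower rows.  Row [r] itself closes [s], so no one in a row
    above is charged to [s], and the charge of type 2 is injective. *)
Definition charge_spec r c (ts : nat * nat) : Prop :=
  let s := ts.2 in
  [\/ [/\ ts.1 = 0, keep r s, s < c, ~~ nested r s c
         & forall b, M r b -> s < b -> c <= b],
      [/\ ts.1 = 1, keep r s, s < c, ~~ nested r s c
         & forall b, M r b -> c < b -> nested r s b]
    | ts.1 = 2 /\ exists a p b',
        [/\ [/\ keep r a, ~~ nested r a b', M r p & M r b'],
            a < p <= s, s < c < b', forall b, M r b -> b < c -> b <= p
          & forall r', r < r' -> ~ closes r' s]].

Lemma charge_exists r c : M r c -> ~~ keep r c -> exists ts, charge_spec r c ts.
Proof.
move=> Mc /(kept_blocked Mc)[a [Ka ac ng]].
have [u0 [Mu0 au0 u0min]] := @first_after (M r) a c Mc ac.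
have [cu|uc] := leqP c u0.
  exists (0, a); apply: Or31; split=> // b Mb ab.
  exact: leq_trans cu (u0min b Mb ab).
have [[b' [Mb' cb' ngb']]|no] :=
    EM (exists b', [/\ M r b', c < b' & ~~ nested r a b']); last first.
  exists (1, a); apply: Or32; split=> // b Mb cb; apply: contraT => nb.
  by case: no; exists b.
have [p [Mp pc pmax]] := @last_before (M r) c u0 Mu0 uc.
have [x /andP[px xc] hx] := open_boundary (leqnn r) Mp Mc pc.
exists (2, x); apply: Or33; split=> //; exists a, p, b'; split=> //.
- by rewrite px andbT; apply: leq_trans au0 (pmax _ Mu0 uc).
- by rewrite xc.
Qed.

Lemma charge_kept r c ts : charge_spec r c ts -> ts.1 < 2 -> keep r ts.2.
Proof. by case=> [[]|[]|[-> _]]. Qed.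

Lemma charge_inj_kept r c c' t s : M r c -> M r c' -> t < 2 ->
  charge_spec r c (t, s) -> charge_spec r c' (t, s) -> c = c'.
Proof.
move=> Mc Mc' t2 [/= [-> _ sc ng hc]|/= [-> _ sc ng hc]|[/= t2']]; last by rewrite t2' in t2.
  case=> /= [[_ _ sc' ng' hc']|[]//|[]//].
  by have := hc _ Mc' sc'; have := hc' _ Mc sc; lia.
case=> /= [[]//|[_ _ sc' ng' hc']|[]//].
have [/(hc _ Mc')|/(hc' _ Mc)|//] := ltngtP c c'; last by rewrite (negbTE ng).
by rewrite (negbTE ng').
Qed.

Lemma charge_inj_open r r' c c' s : M r c -> M r' c' ->
  charge_spec r c (2, s) -> charge_spec r' c' (2, s) -> r = r' /\ c = c'.
Proof.
have spec2 q e : charge_spec q e (2, s) -> exists a p b',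
        [/\ [/\ keep q a, ~~ nested q a b', M q p & M q b'],
            a < p <= s, s < e < b', forall b, M q b -> b < e -> b <= p
          & forall r', q < r' -> ~ closes r' s].
  by case=> [[]|[]|[_]].
have clos q e : M q e -> charge_spec q e (2, s) -> closes q s.
  move=> Me /spec2[a [p [b' [[Ka ng Mp Mb] aps seb _ _]]]].
  by exists a, p, e, b'.
move=> Mc Mc' sc sc'.
have [a [p [b [[Ka ng Mp Mb] aps scb hp hr]]]] := spec2 _ _ sc.
have [a' [p' [b' [[Ka' ng' Mp' Mb'] aps' scb' hp' hr']]]] := spec2 _ _ sc'.
have rr : r = r'.
  by have [/hr|/hr'|//] := ltngtP r r' => -[]; [apply: clos sc' | apply: clos sc].
split=> //; rewrite -rr in hp' Mc'.
have [lt|lt|//] := ltngtP c c'; first by have := hp' _ Mc lt; lia.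
by have := hp _ Mc' lt; lia.
Qed.

Lemma charge_open_lt r c s : M r c -> charge_spec r c (2, s) -> s < n.
Proof.
move=> /M_bound[_ cn] [[]//|[]//|[_ [a [p [b' [_ _ /andP[sc _] _ _]]]]]].
exact: ltn_trans sc cn.
Qed.

End Planar.

(** * Augmenting at the top *)

(** The charges are chosen as a function of the planar relation, so that two
    points of the same slice use the same charges. *)
Lemma charge_function n : exists ts : rel nat -> nat -> nat -> nat * nat,
  forall M : rel nat, (forall r c, M r c -> r < n /\ c < n) ->
  forall r c, M r c -> ~~ keep M r c -> charge_spec M r c (ts M r c).
Proof.
have h (y : rel nat * nat * nat) : exists t : nat * nat,
    (forall r c, y.1.1 r c -> r < n /\ c < n) -> y.1.1 y.1.2 y.2 ->
    ~~ keep y.1.1 y.1.2 y.2 -> charge_spec y.1.1 y.1.2 y.2 t.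
  case: y => -[M r] c /=.
  have [[hM Mc nK]|no] := EM [/\ forall r c, M r c -> r < n /\ c < n, M r c
     & ~~ keep M r c]; first by have [t ht] := charge_exists hM Mc nK; exists t.
  (* a default value, where no charge is required *)
  by exists (0, 0) => hM Mc nK; case: no.
have [f hf] := choice h.
by exists (fun M r c => f (M, r, c)) => M hM r c; apply: (hf (M, r, c)).
Qed.

(** Only the coordinates of [w] other than [i] and [l] matter
    ([slice_upd_col], [slice_upd_row]). *)
Definition slice d (n : 'I_d -> nat) (A : array n) (i l : 'I_d)
    (w : 'I_d -> nat) : rel nat :=
  fun r c => entry (Mat A) (upd (upd w l r) i c).

Section Slice.

Variables (d n : nat) (A : array (fun _ : 'I_d => n)) (i l : 'I_d).
Hypothesis il : i != l.

Lemma slice_upd_col w c : slice A i l (upd w i c) = slice A i l w.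
Proof.
apply: funext => r; apply: funext => b; rewrite /slice.
by rewrite (updC _ _ _ il) upd_upd.
Qed.

Lemma slice_upd_row w r : slice A i l (upd w l r) = slice A i l w.
Proof. by apply: funext => q; apply: funext => b; rewrite /slice upd_upd. Qed.

Lemma slice_bound w r c : slice A i l w r c -> r < n /\ c < n.
Proof.
move=> h; split; last by have := entry_lt i h; rewrite upd_same.
by have := entry_lt l h; rewrite /upd eqxx eq_sym (negbTE il).
Qed.

Lemma slice_pos (z : idx (fun=> n)) : slice A i l (pos z) (pos z l) (pos z i) = A z.
Proof. by rewrite /slice upd_id upd_id entry_pos. Qed.

Definition keep_at (z : idx (fun=> n)) : bool :=
  keep (slice A i l (pos z)) (pos z l) (pos z i).

Definition keep_array : array (fun _ : 'I_d => n) :=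
  [ffun z => A z && keep_at z].

Lemma mem_keep_array z :
  keep_array z = keep (slice A i l (pos z)) (pos z l) (pos z i).
Proof.
rewrite ffunE /keep_at; case K: (keep _ _ _); last by rewrite andbF.
by rewrite andbT -slice_pos (kept_one K).
Qed.

(** Deleted ones of types 0 and 1 inject into the kept ones, and those of type
    2 into the points with [l]-th coordinate 0: the charged column replaces the
    coordinate [i], and it determines the row within the slice, so that the
    coordinate [l] can be forgotten. *)
Lemma weight_keep_array : weight A <= 3 * weight keep_array + n ^ (d - 1).
Proof.
have [ts tsP] := charge_function n.
pose t (z : idx (fun=> n)) := ts (slice A i l (pos z)) (pos z l) (pos z i).
pose D m := [set z | [&& A z, ~~ keep_at z & (t z).1 == m]].
have DP m z : z \in D m -> [/\ slice A i l (pos z) (pos z l) (pos z i),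
    charge_spec (slice A i l (pos z)) (pos z l) (pos z i) (m, (t z).2)
    & (t z).1 = m].
  rewrite inE => /and3P[Az nK /eqP tm]; split=> //; first by rewrite slice_pos.
  rewrite -tm -surjective_pairing; apply: tsP => //; first exact: slice_bound.
  by rewrite slice_pos.
have Dkept m : m < 2 -> #|D m| <= weight keep_array.
  move=> m2; pose g (z : idx (fun=> n)) := mkidx z (upd (pos z) i (t z).2).
  have Kt z : z \in D m -> keep (slice A i l (pos z)) (pos z l) (t z).2.
    by move=> /DP[_ /charge_kept h _]; apply: h.
  have gE z : z \in D m -> pos (g z) = upd (pos z) i (t z).2.
    move=> zD; apply: mkidxK => k; rewrite /upd; case: eqP => _; last exact: ltn_ord.
    by have [_] := slice_bound (kept_one (Kt z zD)).
  rewrite -(@card_in_imset _ _ g (D m)) => [|z z' zD zD' gzz].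
    apply: subset_leq_card; apply/subsetP=> _ /imsetP[z zD ->]; rewrite inE.
    rewrite mem_keep_array gE // slice_upd_col upd_same.
    by rewrite /upd eq_sym (negbTE il) Kt.
  have E : upd (pos z) i (t z).2 = upd (pos z') i (t z').2 by rewrite -!gE // gzz.
  have Es : (t z).2 = (t z').2 by rewrite -(upd_same (pos z) i (t z).2) E upd_same.
  have El : pos z l = pos z' l.
    have := congr1 (fun h => h l) E.
    by rewrite /upd eq_sym (negbTE il).
  have eM : slice A i l (pos z) = slice A i l (pos z').
    by rewrite -(slice_upd_col _ (t z).2) E slice_upd_col.
  have [Mz sz _] := DP _ _ zD; have [Mz' sz' _] := DP _ _ zD'.
  rewrite eM El Es in Mz sz.
  have Ei := charge_inj_kept Mz Mz' m2 sz sz'.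
  apply: pos_inj; rewrite -(upd_id (pos z) i) -(upd_id (pos z') i) Ei.
  by rewrite -(upd_upd (pos z) i (t z).2) E upd_upd.
have Dopen : #|D 2| <= n ^ (d - 1).
  apply: leq_trans (card_bottom n l).
  pose g (z : idx (fun=> n)) := mkidx z (upd (upd (pos z) i (t z).2) l 0).
  have gE z : z \in D 2 -> pos (g z) = upd (upd (pos z) i (t z).2) l 0.
    move=> zD; have [Mz sz _] := DP _ _ zD.
    apply: mkidxK => k; rewrite /upd; case: eqP => _.
      exact: leq_ltn_trans (leq0n (z i)) (ltn_ord _).
    case: eqP => _; last exact: ltn_ord.
    exact: (charge_open_lt (@slice_bound (pos z)) Mz sz).
  rewrite -(@card_in_imset _ _ g (D 2)) => [|z z' zD zD' gzz].
    apply: subset_leq_card; apply/subsetP=> _ /imsetP[z zD ->]; rewrite inE.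
    by have := congr1 (fun h => h l) (gE z zD); rewrite upd_same /pos => ->.
  have E : upd (upd (pos z) i (t z).2) l 0 = upd (upd (pos z') i (t z').2) l 0.
    by rewrite -!gE // gzz.
  have Es : (t z).2 = (t z').2.
    by have := congr1 (fun h => h i) E; rewrite /upd (negbTE il) eqxx.
  have eM : slice A i l (pos z) = slice A i l (pos z').
    rewrite -(slice_upd_col _ (t z).2) -(slice_upd_row _ 0) E.
    by rewrite slice_upd_row slice_upd_col.
  have [Mz sz _] := DP _ _ zD; have [Mz' sz' _] := DP _ _ zD'.
  rewrite eM Es in Mz sz.
  have [El Ei] := charge_inj_open Mz Mz' sz sz'.
  apply: pos_inj; apply: funext => k.
  have [->//|kl] := eqVneq k l; have [->//|ki] := eqVneq k i.
  by have := congr1 (fun h => h k) E; rewrite /upd (negbTE kl) (negbTE ki).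
have sub : [set z | A z] \subset [set z | keep_array z] :|: (D 0 :|: D 1 :|: D 2).
  apply/subsetP => z; rewrite !inE ffunE => Az; rewrite Az /=.
  case K: (keep_at z) => //=.
  have Mz : slice A i l (pos z) (pos z l) (pos z i) by rewrite slice_pos.
  have := tsP _ (@slice_bound (pos z)) _ _ Mz (negbT K).
  by case=> [[e _ _ _]|[e _ _ _]|[e _]]; rewrite /t e.
apply: leq_trans (subset_leq_card sub) _.
apply: leq_trans (leq_card_setU _ _) _; rewrite mulSn -addnA leq_add2l.
apply: leq_trans (leq_card_setU _ _) _; apply: leq_add => //.
apply: leq_trans (leq_card_setU _ _) _; rewrite mul2n -addnn.
by apply: leq_add; apply: Dkept.
Qed.

End Slice.

(** In a copy of [P] among the kept ones, the two adjacent ones of the top row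
    are kept in the same row, so a row above has ones at [m1 < m2] strictly
    between them: these are the two ones of the new top plane. *)
Lemma extremal_top_augment d n (P : mat d) (i l : 'I_d) (x : idx (side P)) :
  i != l -> P x -> entry P (upd (pos x) i (x i).+1) -> x l = 0 :> nat ->
  extremal n (top_augment i l x) <= 3 * extremal n P + n ^ (d - 1).
Proof.
move=> il Px Py xl; apply: extremal_le => A nA.
apply: leq_trans (weight_keep_array A il) _; rewrite leq_add2r leq_mul2l /=.
apply: weight_le_extremal; apply: contra nA => /containsP[f cf].
have li : (l == i) = false by rewrite eq_sym (negbTE il).
have Pu : entry P (pos x) by rewrite entry_pos.
have [incf ltf fP] := cf.
have cA : copy A P f by apply: copy_sub cf => z; rewrite ffunE => /andP[].
have /entryP[z Kz zE] := fP _ Pu; have /entryP[z' Kz' zE'] := fP _ Py.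
rewrite /= mem_keep_array // in Kz; rewrite /= mem_keep_array // in Kz'.
have zz : pos z' = upd (pos z) i (pos z' i).
  by rewrite zE' zE; apply: funext => k; rewrite /upd; case: eqVneq => // ->; rewrite eqxx.
have zl : pos z' l = pos z l by rewrite zz /upd li.
rewrite zz slice_upd_col // -zz zl in Kz'.
have ltP : (x i).+1 < side P i by have := entry_lt i Py; rewrite upd_same.
have zi : pos z i = f i (x i) by rewrite zE.
have zi' : pos z' i = f i (x i).+1 by rewrite zE' upd_same.
have ltz : pos z i < pos z' i by rewrite zi zi'; apply: incf.
have /asboolP[q [m1 [m2 [qr zm1 m12 m2z [M1 M2]]]]] := keep_nested Kz Kz' ltz.
pose h t := if t == 0 then m1 else m2.
have m2n : m2 < n by have [] := slice_bound il M2.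
apply/containsP; exists (insert_map l 0 1 (fun=> q) (insert_map i (x i).+1 2 h f)).
apply: copy_insert => //.
- apply: copy_insert => //.
  + by move=> [|a] [|[|b]].
  + by move=> [|t] _; rewrite /h //=; apply: ltn_trans m2n.
  + move=> a t ax _; have : f i a <= pos z i.
      by rewrite zi; apply: copy_leq cf _ _ => //; apply: ltnW.
    by move/leq_ltn_trans; apply; rewrite /h; case: eqP => // _; apply: ltn_trans m12.
  + move=> a t xa alt _; have : pos z' i <= f i a.
      by rewrite zi'; apply: copy_leq cf _ _.
    by apply: leq_trans; rewrite /h; case: eqP => // _; apply: ltn_trans m2z.
- by move=> a b ab; rewrite ltnS leqn0 => /eqP b0; move: ab; rewrite b0.
- by move=> t _; have [] := slice_bound il M2.
- move=> a t _; rewrite /= li => alt _; rewrite /insert_map li.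
  apply: leq_trans qr _; rewrite zE (xl : pos x l = 0); apply: copy_leq cf _ _ => //.
move=> w /andP[/same_rowP wE wi] _ _.
have [s Ms [s2 sE]] : exists2 s, slice A i l (pos z) q (h s) & s < 2 /\ w i = (x i).+1 + s.
  by case/orP: wi => /eqP ->; [exists 0 | exists 1]; rewrite ?addn0 ?addn1.
move: Ms; rewrite /slice -(updC _ _ _ il); congr (is_true (entry _ (upd _ _ _))).
apply: funext => k; rewrite /insert_map {1}/upd; case: eqVneq => [-> | ki].
  by rewrite sE ltnNge leq_addr /= ltn_add2l s2 addKn.
by rewrite zE wE /upd (negbTE ki).
Qed.

(** * The five operations *)

Definition linear_extremal d (P : mat d) K :=
  forall n, extremal n P <= K * n ^ (d - 1).

Lemma adjacent_entry d (P : mat d) i (x y : idx (side P)) :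
  adjacent_ones i x y -> entry P (upd (pos x) i (x i).+1).
Proof. by case=> _ Py /same_rowP xy <-; rewrite -xy entry_pos. Qed.

Lemma ramsey_end_planes d (P : mat d) K F : 0 < d -> linear_extremal P K ->
  by_end_planes P F -> linear_ramsey (fun j => hypergraph_of (F j)).
Proof.
move=> d0 hK [_ hF].
have h j Q : add_end_planes P j Q ->
    nvert (hypergraph_of Q) = nvert (hypergraph_of P) + j /\
    linear_extremal Q (K + j).
  elim=> [|{}j {}Q Q' _ [vQ eQ] [i [x [Qx xi]]]]; first by rewrite !addn0.
  rewrite -[Q x]entry_pos in Qx; split=> [|n].
    by case: xi => -[_ ->]; rewrite nvert_insert vQ addn1 addnS.
  rewrite addnS mulSn addnC; case: xi => -[xi ->].
    by apply: leq_trans (extremal_first_plane n Qx xi) _; rewrite leq_add2r.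
  by apply: leq_trans (extremal_last_plane n Qx xi) _; rewrite leq_add2r.
apply: (@linear_of_extremal _ _ K.+1) => // [j n j1|j j1].
  have [_ /(_ n)/leq_trans] := h _ _ (hF j j1); apply.
  by rewrite leq_mul2r mulSn addnC leq_add2l leq_pmulr ?orbT.
by have [-> _] := h _ _ (hF j j1); apply: leq_addl.
Qed.

Lemma ramsey_stretch d (P : mat d) K F (i : 'I_d) u
    (B : ('I_d -> nat) -> bool) : 0 < d ->
  linear_extremal P K -> entry P u -> entry P (upd u i (u i).+1) ->
  (forall w, B w -> same_row i u w) ->
  (forall j, 1 <= j -> F j = insert_planes i (u i).+1 j B P) ->
  linear_ramsey (fun j => hypergraph_of (F j)).
Proof.
move=> d0 hK Pu Pv hB hF.
apply: (@linear_of_extremal _ _ (2 * K)) => // [j n j1|j j1]; rewrite hF //.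
  apply: leq_trans (extremal_row_stretch n j Pu Pv hB) _.
  by have := hK n; move: (extremal n P) (n ^ _) => e m; nia.
by rewrite nvert_insert leq_addl.
Qed.

Lemma top_augment_one d (P : mat d) (i l : 'I_d) (x : idx (side P)) c :
  i != l -> x l = 0 :> nat -> (c == (x i).+1) || (c == (x i).+2) ->
  (x i).+1 < side P i ->
  entry (top_augment i l x) (upd (pos x) i c).
Proof.
move=> il xl hc ltP; have li : (l == i) = false by rewrite eq_sym (negbTE il).
rewrite entry_build; apply/andP; split.
  apply/forallP=> k; rewrite /= /upd; case: (eqVneq k i) => [-> | ki].
    by rewrite (negbTE il); move: hc ltP; lia.
  by apply: leq_trans (ltn_ord (x k)) _; case: ifP => // _; apply: leq_addr.
have -> : upd (pos x) i c l = 0 by rewrite /upd li.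
rewrite /= upd_same hc andbT; apply/same_rowP.
by rewrite upd_same.
Qed.

(** After the augmentation, what remains is a row stretch of the augmented
    matrix between its two ones in the top plane, which have positions
    [(x i).+1] and [(x i).+2] in their row. *)
Lemma ramsey_top_stretch d (P : mat d) K F : 2 <= d -> linear_extremal P K ->
  by_top_stretch P F -> linear_ramsey (fun j => hypergraph_of (F j)).
Proof.
move=> d2 hK [i [l [x [y [[i0 ld] adj xl hF]]]]].
have il : i != l by apply/eqP => /(congr1 (@nat_of_ord d)); lia.
have [Px _ _ _] := adj; have Py := adjacent_entry adj.
have ltP : (x i).+1 < side P i by have := entry_lt i Py; rewrite upd_same.
apply: (@ramsey_stretch _ (top_augment i l x) (3 * K).+1 _ i
          (upd (pos x) i (x i).+1) (fun w => same_row i (pos x) w && (w l == 0))).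
- exact: ltnW.
- move=> n; apply: leq_trans (extremal_top_augment n il Px Py xl) _.
  by rewrite [(3 * K).+1 * _]mulSn addnC leq_add2l -mulnA leq_mul2l hK.
- by apply: top_augment_one; rewrite ?eqxx.
- by rewrite upd_same upd_upd; apply: top_augment_one; rewrite ?eqxx ?orbT.
- by move=> w /andP[/same_rowP xw _]; apply/same_rowP; rewrite upd_upd.
- by move=> j j1; rewrite upd_same; apply: hF.
Qed.

(** If some side is at least 2, it grows with each copy, so the size of the
    matrices is at least [j]. *)
Lemma ramsey_corner_glue d (P : mat d) K F : 0 < d -> linear_extremal P K ->
  by_corner_glue P F -> linear_ramsey (fun j => hypergraph_of (F j)).
Proof.
move=> d0 hK [s [Pc Pc' F0 FS]].
have [[i Pi]|small] := EM (exists i, 1 < side P i); last first.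
  apply: (@linear_of_upper _ _ 1) => j _; exists (nvert (hypergraph_of (F j))).
    apply: ramsey_few_ones; apply: le1_few_ones => i.
    have Pi : side P i <= 1 by rewrite leqNgt; apply/negP => ?; case: small; exists i.
    elim: j => [|j IH]; first by rewrite F0.
    by rewrite FS /=; lia.
  by rewrite mul1n.
have h j : [/\ entry (F j) (corner (side (F j)) (fun i => ~~ s i)),
    linear_extremal (F j) (j.+1 * K) & j.+1 < side (F j) i].
  elim: j => [|j [Fc Fe Fs]]; first by rewrite F0 mul1n.
  rewrite FS; split=> [|n|]; first exact: glue_corner.
    apply: leq_trans (extremal_glue n Fc Pc) _.
    by rewrite [j.+2 * K]mulSn addnC mulnDl leq_add.
  by rewrite /=; lia.
apply: (@linear_of_extremal _ _ (2 * K)) => // [j n j1|j j1].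
  have [_ /(_ n)/leq_trans h2 _] := h j; apply: h2.
  by rewrite leq_mul2r; apply/orP; right; nia.
have [_ _ lt] := h j; rewrite /= (bigD1 i) //=.
by apply: leq_trans (leq_addr _ _); apply/ltnW/ltnW.
Qed.

Lemma ramsey_by_spread d (P : mat d) K F : 0 < d -> linear_extremal P K ->
  by_spread P F -> linear_ramsey (fun j => hypergraph_of (F j)).
Proof.
move=> d0 hK hF.
have [[i Pi]|small] := EM (exists i, 1 < side P i); last first.
  apply: (@linear_of_upper _ _ 1) => j j1; exists (nvert (hypergraph_of (F j))).
    apply: ramsey_few_ones; apply: le1_few_ones => i; rewrite hF //=.
    have Pi : side P i <= 1 by rewrite leqNgt; apply/negP => ?; case: small; exists i.
    by case: (side P i) Pi => [|[|]].
  by rewrite mul1n.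
pose m := (2 * K).+1.
apply: (@linear_of_upper _ _ (d * m)) => j j1; exists (d * (m * j.+1)).
  rewrite hF //; apply: ramsey_spread.
  apply: (@leq_ltn_trans (2 * (K * m ^ (d - 1)))); first by rewrite leq_mul2l hK.
  by rewrite -{2}(subnK d0) addn1 expnS mulnA ltn_pmul2r ?expn_gt0.
rewrite hF // -mulnA !leq_mul2l; apply/orP; right; apply/orP; right.
rewrite /= (bigD1 i) //=; apply: leq_trans (leq_addr _ _).
by case: (side P i) Pi => [|[|k]] //= _; nia.
Qed.

Theorem theorem28 (d : nat) (hd : 2 <= d) (P : mat d) (hP : ex_bigO P)
    (F : nat -> mat d)
    (hF : by_end_planes P F \/ by_row_stretch P F \/ by_top_stretch P F \/
          by_corner_glue P F \/ by_spread P F) :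
  linear_ramsey (fun j => hypergraph_of (F j)).
Proof.
have d0 : 0 < d by apply: ltnW.
have [K hK] := ex_bigO_bound d0 hP.
case: hF => [|[|[|[|]]]].
- exact: ramsey_end_planes.
- case=> [i [x [y [_ adj hF]]]]; have [Px _ _ _] := adj.
  apply: (@ramsey_stretch _ P K _ i (pos x) (same_row i (pos x))) => //.
    by rewrite entry_pos.
  exact: adjacent_entry adj.
- exact: ramsey_top_stretch.
- exact: ramsey_corner_glue.
- exact: ramsey_by_spread.
Qed.
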